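(* Let $\mathbf F_r\in\mathcal Q^{\mathbf t}_r$ and let $h=\mathrm{Cons}(\mathbf F_r)$. The origin of $\dot{\mathbf x}=\mathbf F_r(\mathbf x)$ is monodromic if and only if the Hamiltonian vector field $\mathbf X_h$ has a center at the origin.
   Context: Let $\mathbf t=(t_1,t_2)$ with $t_1\le t_2$ coprime positive integers, $|\mathbf t|=t_1+t_2$, and $r$ a nonnegative integer. $\mathcal P^{\mathbf t}_k$ is the space of real polynomials $p(x,y)$ with $p(\varepsilon^{t_1}x,\varepsilon^{t_2}y)=\varepsilon^kp(x,y)$. $\mathcal Q^{\mathbf t}_r$ is the space of polynomial vector fields $\mathbf F=(P,Q)^T$ with $P\in\mathcal P^{\mathbf t}_{r+t_1}$, $Q\in\mathcal P^{\mathbf t}_{r+t_2}$. Put $\mathbf X_h=(-\partial h/\partial y,\partial h/\partial x)^T$ and $\mathbf D_0=(t_1x,t_2y)^T$. Each $\mathbf F_r\in\mathcal Q^{\mathbf t}_r$ is uniquely $\mathbf F_r=\mathbf X_h+\mu\mathbf D_0$ with $h=\frac1{r+|\mathbf t|}(t_1xQ-t_2yP)\in\mathcal P^{\mathbf t}_{r+|\mathbf t|}$ and $\mu=\frac1{r+|\mathbf t|}\left(\frac{\partial P}{\partial x}+\frac{\partial Q}{\partial y}\right)\in\mathcal P^{\mathbf t}_r$; $\mathrm{Cons}(\mathbf F_r):=h$. A singular point is a center if it has a punctured neighborhood filled with periodic orbits surrounding it; it is a focus if the orbits in a punctured neighborhood spiral towards it in forward time or in backward time. It is monodromic if the orbits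 rotate around it; for analytic systems this means that it is a center or a focus. *)

(* Defs.v *)
From mathcomp Require Import all_boot all_order all_algebra.
From mathcomp Require Import all_classical all_reals all_analysis.
(* The notations of mpoly clash with those of MathComp-Analysis; everything
   else (canonical instances in particular) is needed. *)
From mathcomp Require mpoly.
Import -(notations) mpoly.
Import Order.TTheory GRing.Theory Num.Theory.
Import numFieldNormedType.Exports.

Set Implicit Arguments.
Unset Strict Implicit.
Unset Printing Implicit Defensive.

Local Open Scope classical_set_scope.
Local Open Scope ring_scope.

(* Polynomials in (x, y): the variable of index 0 is x, that of index 1 is y. *)
Definition bipoly (R : realType) := mpoly 2 R.

Definition varx {R : realType} : bipoly R := mpolyX R (mnm1 (0 : 'I_2)).
Definition vary {R : realType} : bipoly R := mpolyX R (mnm1 (1 : 'I_2)).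

Definition dx {R : realType} (p : bipoly R) : bipoly R := mderiv (0 : 'I_2) p.
Definition dy {R : realType} (p : bipoly R) : bipoly R := mderiv (1 : 'I_2) p.

Definition peval {R : realType} (p : bipoly R) (z : R * R) : R :=
  meval (fun i : 'I_2 => if i == 0 then z.1 else z.2) p.

Record vfield (R : realType) := VField { fstc : bipoly R; sndc : bipoly R }.

Section QuasiHomogeneous.
Variables (R : realType) (t1 t2 : nat).

Definition qhomog (k : nat) (p : bipoly R) : Prop :=
  forall e x y : R,
    peval p (e ^+ t1 * x, e ^+ t2 * y) = e ^+ k * peval p (x, y).

Definition qhomog_vfield (r : nat) (F : vfield R) : Prop :=
  qhomog (r + t1) (fstc F) /\ qhomog (r + t2) (sndc F).

Definition conservative_part (r : nat) (F : vfield R) : bipoly R :=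
  ((r + (t1 + t2))%:R : R)^-1 *:
    (t1%:R * varx * sndc F - t2%:R * vary * fstc F).

End QuasiHomogeneous.

Definition hamiltonian {R : realType} (h : bipoly R) : vfield R :=
  VField (- dy h) (dx h).

Section Dynamics.
Variable R : realType.
Implicit Types (F : vfield R) (I : set R) (g : R -> R * R) (p : R * R).

Definition singular F p : Prop :=
  peval (fstc F) p = 0 /\ peval (sndc F) p = 0.

(* Derivatives are two-sided, also at the end points of I when I is closed;
   this only constrains how a solution is extended as a function outside I. *)
Definition solution_on F I g : Prop :=
  forall t, I t ->
    is_derive t (1 : R) (fun s => (g s).1) (peval (fstc F) (g t)) /\
    is_derive t (1 : R) (fun s => (g s).2) (peval (sndc F) (g t)).

(* The origin lies in a bounded component of the complement of O; for a Jordan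
   curve O, in its interior. *)
Definition surrounds_origin (O : set (R * R)) : Prop :=
  ~ O 0 /\ bounded_set (connected_component (~` O) 0).

Definition periodic_solution F g : Prop :=
  [/\ solution_on F setT g,
      exists2 T : R, 0 < T & forall t, g (t + T) = g t
    & exists t, g t <> g 0].

Definition center_at_origin F : Prop :=
  singular F 0 /\
  \forall p \near (0 : R * R)^',
    exists g, [/\ periodic_solution F g, g 0 = p
                & surrounds_origin (range g)].

(* The path g avoids the origin on [0, T], and its continuous polar angle
   varies by 2 pi, in either direction. *)
Definition full_turn (T : R) g : Prop :=
  exists rho theta : R -> R,
    [/\ {within `[0, T], continuous theta},
        forall t, t \in `[0, T] ->
          0 < rho t /\ g t = (rho t * cos (theta t), rho t * sin (theta t))
      & `|theta T - theta 0| = 2 * pi].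

(* The orbits rotate around the origin: inside any neighborhood V of the
   origin, every orbit starting close enough to it makes a full turn around it
   before possibly leaving V (so that a first return map is defined).  Without
   V, turns made far away from the origin would count. *)
Definition monodromic_at_origin F : Prop :=
  singular F 0 /\
  forall V : set (R * R), nbhs (0 : R * R) V ->
  \forall p \near (0 : R * R)^',
    exists (T : R) (g : R -> R * R),
      [/\ 0 < T, solution_on F `[0, T] g, g 0 = p,
          forall t, t \in `[0, T] -> V (g t)
        & full_turn T g].

End Dynamics.

(* Main.v *)
Require Import Defs.
From mathcomp Require Import all_boot all_order all_algebra.
From mathcomp Require Import all_classical all_reals all_analysis.
From mathcomp Require mpoly.
From mathcomp Require Import ring lra.
Import -(notations) mpoly.
Import Order.TTheory GRing.Theory Num.Theory.
Import numFieldNormedType.Exports.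

Set Implicit Arguments.
Unset Strict Implicit.
Unset Printing Implicit Defensive.

Local Open Scope classical_set_scope.
Local Open Scope ring_scope.

(** Write D_0 = (t1 x, t2 y) and |t| = t1 + t2. Everything is governed by the
    wedge product w = t1 x Q - t2 y P of D_0 and F, which measures how fast F
    turns across the curves e |-> (e^t1 x, e^t2 y). It equals (r + |t|) h, and
    by Euler's identity for h the wedge product of D_0 and X_h is (r + |t|) h
    as well. So both sides of the equivalence follow from properties of w for
    weighted homogeneous fields: a monodromic origin or a center forces w <> 0
    off the origin ([monodromic_wedge_neq0], [center_wedge_neq0]); conversely,
    if w <> 0 off the origin, then the origin is monodromic
    ([wedge_neq0_monodromic]), and it is a center if the field is Hamiltonian
    ([hamiltonian_center]).

    Obstruction. Along every orbit w' = (div F) w. If w(q) = 0 with q <> 0, then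
    w vanishes at all the points (e^t1 q1, e^t2 q2), hence at points as close to
    the origin as desired, and along the orbits through them. Where w = 0, F is
    a multiple nu D_0 of D_0, so that x' = t1 nu x and y' = t2 nu y: both
    coordinates keep their signs along the orbit, which never meets the ray
    opposite to its initial point ([wedge0_quadrant]). A full turn meets this
    ray, and so does a curve around the origin, since the ray joins the origin
    to infinity.

    Construction. In the coordinates x = rho^t1 cos th, y = rho^t2 sin th the
    equations of F separate into d rho / d th = kappa(th) rho and
    d t / d th = sigma(th) / rho^r, where kappa and sigma are continuous with
    denominator w(cos th, sin th). Two quadratures and the inversion of th |-> t
    give the orbits explicitly ([orbit_solution]); the existence theory of
    differential equations is not involved. While th runs over an interval of
    length 3 pi, rho changes by a bounded factor only, so that an orbit starting
    near the origin stays near it, and the ordinary polar angle, which differs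
    from th by less than pi / 2, varies by at least 2 pi. For X_h, conservation
    of h makes rho a 2 pi-periodic function of th: the orbit is closed. It is a
    whole level set of h. On the component of the origin in its complement, h
    divided by its value on the orbit is less than 1, which bounds rho there
    ([orbit_curve_surrounds]). *)

(** * One-variable calculus *)
Section Calculus.
Variable R : realType.
Implicit Types (f g : R -> R) (a b x y : R).

Local Notation D f x d := (is_derive (x : R) (1 : R) (f : R -> R) (d : R)).

(** The derivation rules below are in pointwise form, so that the derivative of
    a composite expression is obtained by applying one to another. *)
Lemma drv_eq f g x a b : D f x a -> f =1 g -> a = b -> D g x b.
Proof. by move=> Df /funext <- <-. Qed.

Lemma drv_cst c x : D (fun=> c) x 0.
Proof. exact: is_derive_cst. Qed.

Lemma drv_id x : D (fun y => y) x 1.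
Proof. exact: is_derive_id. Qed.

Lemma drvD f g x a b : D f x a -> D g x b -> D (fun y => f y + g y) x (a + b).
Proof. move=> Df Dg; exact: (is_deriveD Df Dg). Qed.

Lemma drvB f g x a b : D f x a -> D g x b -> D (fun y => f y - g y) x (a - b).
Proof. move=> Df Dg; exact: (is_deriveB Df Dg). Qed.

Lemma drvM f g x a b : D f x a -> D g x b ->
  D (fun y => f y * g y) x (a * g x + f x * b).
Proof.
move=> Df Dg; apply: (drv_eq (is_deriveM Df Dg)) => //.
by rewrite /GRing.scale /=; ring.
Qed.

Lemma drvZ c f x a : D f x a -> D (fun y => c * f y) x (c * a).
Proof. move=> Df; exact: (is_deriveZ c Df). Qed.

Lemma drvX n f x a : D f x a ->
  D (fun y => f y ^+ n) x (n%:R * f x ^+ n.-1 * a).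
Proof.
move=> Df; apply: (drv_eq (is_deriveX n Df)) => [y|]; first by rewrite exprfctE.
  by rewrite /GRing.scale.
Qed.

Lemma drv_comp f g x a b : D f (g x) a -> D g x b ->
  D (fun y => f (g y)) x (a * b).
Proof. by move=> Df Dg; exact: (is_derive1_comp Df Dg). Qed.

Lemma drvV f x a : D f x a -> f x != 0 ->
  D (fun y => (f y)^-1) x (- a / f x ^+ 2).
Proof.
move=> Df f0; apply: (drv_eq (is_deriveV f0 Df)) => //.
by rewrite /GRing.scale /= mulrC mulrN mulNr.
Qed.

Lemma drv_cont f x a : D f x a -> {for x, continuous f}.
Proof.
by move=> [Df _]; exact/differentiable_continuous/derivable1_diffP.
Qed.

Lemma drv_within f (A : set R) : (forall x, A x -> exists a, D f x a) ->
  {within A, continuous f}.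
Proof.
move=> H; apply: continuous_in_subspaceT => x; rewrite inE => /H[a].
exact: drv_cont.
Qed.

Lemma drv_E f x a : D f x a -> derive1 f x = a.
Proof. by move=> Df; rewrite derive1E derive_val. Qed.

Lemma drv_MVT f f' a b : a <= b -> (forall x, a <= x <= b -> D f x (f' x)) ->
  exists2 c, a <= c <= b & f b - f a = f' c * (b - a).
Proof.
move=> ab Df; have [x|| c] := @MVT_segment R f f' a b ab.
- by rewrite in_itv /= => /andP[ax xb]; apply: Df; rewrite !ltW.
- by apply: drv_within => x /=; rewrite in_itv /= => /Df; exists (f' x).
- by rewrite in_itv /= => cab ->; exists c.
Qed.

(** The end points need not be ordered: in the applications f is a time as a
    function of an angle, and may be increasing or decreasing. *)
Lemma IVT_between f a b v : (forall x, {for x, continuous f}) ->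
  f a <= v <= f b -> exists2 c, a <= c <= b \/ b <= c <= a & f c = v.
Proof.
move=> cf /andP[av vb].
have cw A : {within A, continuous f} by exact: continuous_subspaceT.
case: (leP a b) => ab.
  have [|c] := IVT ab (cw _) (v := v).
    by rewrite (min_idPl (le_trans av vb)) (max_idPr (le_trans av vb)) av vb.
  by rewrite in_itv /= => ? ?; exists c => //; left.
have [|c] := IVT (ltW ab) (cw _) (v := v).
  by rewrite (min_idPr (le_trans av vb)) (max_idPl (le_trans av vb)) av vb.
by rewrite in_itv /= => ? ?; exists c => //; right.
Qed.

(** Growth estimate for u' = nu u with nu bounded by K: the derivative of
    u^2 exp(k t) is (2 nu + k) u^2 exp(k t), so this function is nonincreasing
    for k = - 2 K and nondecreasing for k = 2 K. The first fact shows that u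
    stays zero if it starts at zero; the second that it does not vanish
    otherwise, and then its sign is constant. *)
Lemma linear_ode_sign (u nu : R -> R) (T K : R) :
  (forall t, 0 <= t <= T -> D u t (nu t * u t)) ->
  (forall t, 0 <= t <= T -> `|nu t| <= K) ->
  forall t, 0 <= t <= T -> exists2 c, 0 < c & u t = c * u 0.
Proof.
move=> Du nuK.
have De (k s : R) : D (fun s => expR (k * s)) s (expR (k * s) * (k * 1)).
  by apply: (drv_comp (is_derive_expR _)); apply: drvZ; exact: is_derive_id.
have Dphi k s : 0 <= s <= T -> D (fun s => u s ^+ 2 * expR (k * s)) s
    ((2 * nu s + k) * (u s ^+ 2 * expR (k * s))).
  move=> sT; apply: (drv_eq (drvM (drvX 2 (Du s sT)) (De k s))) => //=.
  by rewrite expr1; ring.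
have pos k s : 0 <= u s ^+ 2 * expR (k * s).
  by rewrite mulr_ge0 ?sqr_ge0 ?expR_ge0.
have up t : 0 <= t <= T -> u t ^+ 2 * expR (- (2 * K) * t) <= u 0 ^+ 2.
  move=> /andP[t0 tT].
  have sT s : 0 <= s <= t -> 0 <= s <= T by case/andP=> -> /le_trans ->.
  have [c /andP[c0 ct]] :=
    drv_MVT t0 (fun s st => Dphi (- (2 * K)) s (sT s st)).
  rewrite mulr0 expR0 mulr1 subr0 => E; rewrite -subr_le0 E.
  rewrite mulr_le0_ge0// mulr_le0_ge0//.
  have := nuK c; rewrite c0 (le_trans ct tT) => /(_ isT);
    rewrite ler_norml => /andP[_]; lra.
have lo t : 0 <= t <= T -> u 0 ^+ 2 <= u t ^+ 2 * expR (2 * K * t).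
  move=> /andP[t0 tT].
  have sT s : 0 <= s <= t -> 0 <= s <= T by case/andP=> -> /le_trans ->.
  have [c /andP[c0 ct]] := drv_MVT t0 (fun s st => Dphi (2 * K) s (sT s st)).
  rewrite mulr0 expR0 mulr1 subr0 => E; rewrite -subr_ge0 E.
  rewrite mulr_ge0// mulr_ge0//.
  have := nuK c; rewrite c0 (le_trans ct tT) => /(_ isT);
    rewrite ler_norml => /andP[+ _]; lra.
move=> t tT; have [u0|u0] := eqVneq (u 0) 0.
  exists 1 => //; rewrite u0 mulr0; apply/eqP;
    rewrite -sqrf_eq0 eq_le sqr_ge0 andbT.
  have := up t tT; rewrite u0 expr0n /=.
  by rewrite pmulr_lle0 // expR_gt0.
have un s : 0 <= s <= T -> u s != 0.
  move=> /lo; apply: contraL => /eqP ->.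
  by rewrite expr0n mul0r -ltNge lt_neqAle sqr_ge0 eq_sym sqrf_eq0 u0.
exists (u t / u 0); last by rewrite divfK.
rewrite ltNge; apply/negP => neg.
case/andP: (tT) => t0 tle.
have cw : {within `[0, t], continuous (fun s => u s / u 0)}.
  apply: drv_within => s /=; rewrite in_itv /= => /andP[s0 st].
  exists (0 * u s + (u 0)^-1 * (nu s * u s)).
  apply: (drv_eq (drvZ (u 0)^-1 (Du s _))); rewrite ?s0 ?(le_trans st)//.
    by move=> y; rewrite mulrC.
  by rewrite mul0r add0r.
have [|c] := IVT t0 cw (v := 0).
  by rewrite divff // ge_min neg orbT le_max ler01.
rewrite in_itv /= => /andP[c0 ct] /eqP;
  rewrite mulf_eq0 invr_eq0 (negbTE u0) orbF.
by apply/negP/un; rewrite c0 (le_trans ct).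
Qed.

Lemma drv_near f g x a : (\forall y \near x, f y = g y) -> D f x a -> D g x a.
Proof. exact: near_eq_is_derive. Qed.

(** The lower bound -1 leaves room on both sides of 0, where two such functions
    are glued in the next lemma. *)
Let halfline_antiderivative f : continuous f ->
  exists2 G : R -> R, G 0 = 0 & forall x, -1 < x -> D G x (f x).
Proof.
move=> cf.
pose F (y : R) : R := (\int[lebesgue_measure]_(t in [set` `[(-1)%R, y]]) (f t)).
exists (fun x => F x - F 0) => [|x x1]; first by rewrite subrr.
have xu : x < x + 1 by rewrite ltrDl.
have fi : lebesgue_measure.-integrable `[-1, x + 1] (EFin \o f).
  apply: continuous_compact_integrable; first exact: segment_compact.
  exact: continuous_subspaceT.
have [dF FE] := continuous_FTC1_closed xu fi x1 (cf x).
have DF : D F x (f x).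
  by rewrite -FE derive1E; exact: derivableP.
by apply: (drv_eq (drvB DF (is_derive_cst (F 0) x 1))) => //; rewrite subr0.
Qed.

(** For x >= 0 the antiderivative of f on the half-line is used, for x < 0 that
    of f(- x), reversed. They agree on ]-1, 0], so the glued function is also
    differentiable at 0. *)
Lemma antiderivative f : continuous f ->
  exists G : R -> R, forall x, D G x (f x).
Proof.
move=> cf; have [A A0 DA] := halfline_antiderivative cf.
have cfN : continuous (fun x => f (- x)).
  by move=> x; apply: (@continuous_comp _ _ _ -%R f);
    [exact: opp_continuous|exact: cf].
have [B B0 DB] := halfline_antiderivative cfN.
have DBN x : x < 1 -> D (fun x => - B (- x)) x (f x).
  move=> x1.
  have := drv_comp (DB (- x) _) (is_deriveNid x 1);
    rewrite ltrN2 opprK => /(_ x1) DB'.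
  by apply: (drv_eq (drvZ (-1) DB')) => [y|]; rewrite ?mulN1r// mulrN1 opprK.
have AB x : -1 < x -> x <= 0 -> A x = - B (- x).
  move=> x1 x0.
  have [y /andP[xy y0]|c _] :=
    @drv_MVT (fun y => A y - - B (- y)) (fun=> 0) x 0 x0.
    apply: (drv_eq (drvB (DA y _) (DBN y _))) => //; rewrite ?subrr//.
      exact: lt_le_trans xy.
    by apply: le_lt_trans y0 _.
  rewrite A0 oppr0 B0 mul0r; lra.
exists (fun x => if 0 <= x then A x else - B (- x)) => x.
case: (leP 0 x) => x0.
  apply: (drv_near (f := A)); last by apply: DA; apply: lt_le_trans x0.
  near=> y; case: (leP 0 y) => // y0; apply: AB; last exact: ltW.
  by near: y; apply: lt_nbhsr; apply: lt_le_trans x0.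
apply: (drv_near (f := fun y => - B (- y))); last by apply: DBN; lra.
near=> y; rewrite leNgt; suff -> : y < 0 by [].
by near: y; exact: lt_nbhsl.
Unshelve. all: by end_near. Qed.

Lemma drv_neq0_inj f f' : (forall x, D f x (f' x)) -> (forall x, f' x != 0) ->
  injective f.
Proof.
move=> Df f0 x y; wlog xy : x y / x <= y.
  by move=> W; case: (leP x y) => [/W//|/ltW /W E /esym /E ->].
move=> fxy; have [c _] := drv_MVT xy (fun z _ => Df z).
by rewrite fxy subrr => /esym /eqP;
  rewrite mulf_eq0 (negbTE (f0 c)) subr_eq0 => /eqP.
Qed.

(** The inverse g is only specified on the range of f, which is open. *)
Lemma drv_inverse f f' : (forall x, D f x (f' x)) -> (forall x, f' x != 0) ->
  exists2 g, cancel f g & forall x, D g (f x) (f' x)^-1.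
Proof.
move=> Df f0; have fI := drv_neq0_inj Df f0.
pose g (y : R) : R := xget 0 [set x | f x = y].
have fK : cancel f g.
  move=> x; apply: fI.
  exact: (@xgetPex _ 0 [set z | f z = f x] (ex_intro _ x erefl)).
exists g => // x; apply: (is_derive_inverse _ _ (Df x) (f0 x)).
  by near=> y; exact: fK.
by near=> y; exact: drv_cont (Df y).
Unshelve. all: by end_near. Qed.

Lemma nonvanishing_sign (f : R -> R) : (forall x, {for x, continuous f}) ->
  (forall x, f x != 0) -> (forall x, 0 < f x) \/ (forall x, f x < 0).
Proof.
move=> cf f0.
case: (pselect (forall x, 0 < f x)) => [|/existsNP[a /negP]]; first by left.
rewrite -leNgt => fa; right=> b; rewrite ltNge; apply/negP => fb.
have [|c _ /eqP] := IVT_between cf (a := a) (b := b) (v := 0);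
  first by rewrite fa fb.
by rewrite (negbTE (f0 c)).
Qed.

Lemma drv0_cst (f : R -> R) : (forall x, D f x 0) -> forall x y, f x = f y.
Proof. by move=> Df x y; exact: is_derive_0_is_cst. Qed.

(** The values f (n p) = f 0 + n L are unbounded in both directions. *)
Lemma additive_period_surj (f : R -> R) (p L : R) :
  (forall x, {for x, continuous f}) -> (forall x, f (x + p) = f x + L) ->
  L != 0 ->
  forall y, exists x, f x = y.
Proof.
move=> cf fp L0 y.
have fn n x : f (x + n%:R * p) = f x + n%:R * L.
  elim: n x => [|n IH] x; first by rewrite !mul0r !addr0.
  by rewrite -natr1 !mulrDl !mul1r !addrA fp IH.
have fN n x : f (x - n%:R * p) = f x - n%:R * L.
  by have := fn n (x - n%:R * p); rewrite subrK => ->; rewrite addrK.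
have [n Hn] : exists n : nat, `|y - f 0| <= n%:R * `|L|.
  exists (Num.bound (`|y - f 0| / `|L|)).
  have Lp : 0 < `|L| by rewrite normr_gt0.
  by rewrite -ler_pdivrMr// ltW// archi_boundP// divr_ge0.
move: Hn; rewrite ler_norml => /andP[H1 H2].
case: (leP 0 L) => Lp; move: H1 H2.
  rewrite ger0_norm// => H1 H2.
  have [|c _ <-] := IVT_between cf (a := 0 - n%:R * p)
    (b := 0 + n%:R * p) (v := y); last by exists c.
  by rewrite fn fN; apply/andP; split; lra.
rewrite ltr0_norm// mulrN => H1 H2.
have [|c _ <-] := IVT_between cf (a := 0 + n%:R * p)
  (b := 0 - n%:R * p) (v := y); last by exists c.
by rewrite fn fN; apply/andP; split; lra.
Qed.

Lemma drv_uniq f x a b : D f x a -> D f x b -> a = b.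
Proof. by move=> /drv_E <- /drv_E <-. Qed.

Lemma drv_bounded f a b : a <= b ->
  (forall t, a <= t <= b -> exists d, D f t d) ->
  exists K, forall t, a <= t <= b -> `|f t| <= K.
Proof.
move=> ab Df.
have cf : {within `[a, b], continuous f}.
  by apply: drv_within => t /=; rewrite in_itv /= => /Df.
have [c1 _ M] := EVT_max ab cf; have [c2 _ m] := EVT_min ab cf.
exists (`|f c1| + `|f c2|) => t tab.
have {M} M : f t <= f c1 by apply: M; rewrite in_itv.
have {m} m : f c2 <= f t by apply: m; rewrite in_itv.
rewrite ler_norml.
have := ler_norm (f c1); have := normr_ge0 (f c1); have := normr_ge0 (f c2).
have := ler_norm (- f c2); rewrite normrN; move: m M; lra.
Qed.

(** The angle can be taken in a fixed compact interval; this later makes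
    estimates uniform in the initial angle. *)
Lemma unit_circle_angle u v : u ^+ 2 + v ^+ 2 = 1 ->
  exists th : R, [/\ - pi <= th <= pi, u = cos th & v = sin th].
Proof.
move=> uv; have u1 : -1 <= u <= 1.
  by rewrite -ler_norml -(@ler_pXn2r _ 2)// ?nnegrE// expr1n real_normK
    ?num_real// -uv lerDl sqr_ge0.
have su : Num.sqrt (1 - u ^+ 2) = `|v|.
  by rewrite -uv addrAC subrr add0r sqrtr_sqr.
case: (leP 0 v) => v0.
  exists (acos u); rewrite acosK; last by rewrite in_itv.
  split; rewrite ?sin_acos ?su ?ger0_norm//.
  rewrite acos_lepi// andbT; apply: le_trans (acos_ge0 u1).
  by rewrite oppr_le0 pi_ge0.
exists (- acos u); rewrite cosN sinN acosK; last by rewrite in_itv.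
split; rewrite ?sin_acos ?su ?ltr0_norm ?opprK//.
rewrite lerN2 acos_lepi//=; apply: (@le_trans _ _ 0); last exact: pi_ge0.
by rewrite oppr_le0 acos_ge0.
Qed.

Lemma periodicn (T : Type) (g : R -> T) (p : R) : (forall t, g (t + p) = g t) ->
  forall n t, g (t + n%:R * p) = g t.
Proof.
move=> gp; elim=> [|n IH] t; first by rewrite mul0r addr0.
by rewrite -natr1 mulrDl mul1r addrA gp.
Qed.

Lemma ge0_shift (t p : R) : 0 < p -> exists n : nat, 0 <= t + n%:R * p.
Proof.
move=> p0; exists (Num.bound (`|t| / p)).
have := archi_boundP (divr_ge0 (normr_ge0 t) (ltW p0)).
rewrite ltr_pdivrMr// => /ltW.
have := ler_norm (- t); rewrite normrN; lra.
Qed.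

(** * Evaluation of bivariate polynomials *)

Lemma peval_mon (m : multinom 2) (z : R * R) :
  peval (mpolyX R m) z = z.1 ^+ m 0 * z.2 ^+ m 1.
Proof.
by rewrite /peval mevalX !big_ord_recl big_ord0 /= mulr1;
  congr (_ * _ ^+ m _); apply/val_inj.
Qed.

Lemma pevalD (p q : bipoly R) z : peval (p + q) z = peval p z + peval q z.
Proof. exact: mevalD. Qed.

Lemma pevalB (p q : bipoly R) z : peval (p - q) z = peval p z - peval q z.
Proof. exact: mevalB. Qed.

Lemma pevalN (p : bipoly R) z : peval (- p) z = - peval p z.
Proof. exact: mevalN. Qed.

Lemma pevalM (p q : bipoly R) z : peval (p * q) z = peval p z * peval q z.
Proof. exact: mevalM. Qed.

Lemma pevalZ (c : R) (p : bipoly R) z : peval (c *: p) z = c * peval p z.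
Proof. exact: mevalZ. Qed.

Lemma peval_varx z : peval (varx : bipoly R) z = z.1.
Proof. exact: mevalXU. Qed.

Lemma peval_vary z : peval (vary : bipoly R) z = z.2.
Proof. exact: mevalXU. Qed.

Lemma peval_nat n z : peval (n%:R : bipoly R) z = n%:R.
Proof.
by rewrite -mulr_natr mul1r /peval mevalMn meval1.
Qed.

(** The chain rule, by induction on the monomials of p. *)
Lemma peval_drv (p : bipoly R) (x y : R -> R) (t x' y' : R) :
  D x t x' -> D y t y' ->
  D (fun s => peval p (x s, y s)) t
    (peval (dx p) (x t, y t) * x' + peval (dy p) (x t, y t) * y').
Proof.
move=> Dx Dy; elim/mpolyind: p => [|c m p _ _ IH].
  apply: (drv_eq (is_derive_cst (0 : R) t 1)) => [s|];
    rewrite /dx /dy ?mderiv0 /peval !meval0//.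
  by rewrite !mul0r addr0.
have DM := drvZ c (drvM (drvX (m 0) Dx) (drvX (m 1) Dy)).
apply: (drv_eq (drvD DM IH)) => [s|].
  by rewrite pevalD pevalZ peval_mon.
rewrite /dx /dy !mderivD !mderivZ !mderivX !pevalD !pevalZ !peval_mon.
rewrite !mnmBE !mnmE /= !subn0 !subn1; ring.
Qed.

Lemma peval_continuous (p : bipoly R) : continuous (peval p : R * R -> R).
Proof.
elim/mpolyind: p => [|c m p _ _ IH].
  have -> : peval (0 : bipoly R) = cst 0 by apply/funext => z; exact: meval0.
  exact: cst_continuous.
have -> : peval (c *: mpolyX R m + p) =
    (fun z : R * R => c * (z.1 ^+ m 0 * z.2 ^+ m 1) + peval p z).
  by apply/funext => z; rewrite pevalD pevalZ peval_mon.
move=> z; apply: cvgD; last exact: IH.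
apply: cvgM; first exact: cvg_cst.
apply: cvgM.
  exact: (continuous_comp (@cvg_fst _ _ _ _ _) (@exprn_continuous _ _ _)).
exact: (continuous_comp (@cvg_snd _ _ _ _ _) (@exprn_continuous _ _ _)).
Qed.

End Calculus.

(** * Weighted polar coordinates *)

Section QuasiHomogeneous.
Variables (R : realType) (t1 t2 : nat).
Hypotheses (t1_gt0 : (0 < t1)%N) (t2_gt0 : (0 < t2)%N) (le_t12 : (t1 <= t2)%N).

Local Notation D f x d := (is_derive (x : R) (1 : R) (f : R -> R) (d : R)).

Definition qpolar (rho th : R) : R * R :=
  (rho ^+ t1 * cos th, rho ^+ t2 * sin th).

(** The squared norm of (e^t1 x, e^t2 y) vanishes at e = 0 and is unbounded in
    e, hence equals 1 for some e > 0; then rho = 1 / e. *)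
Lemma qpolar_surj (z : R * R) : z != 0 ->
  exists rho th, [/\ 0 < rho, - pi <= th <= pi & z = qpolar rho th].
Proof.
case: z => x y; rewrite xpair_eqE negb_and => xy0.
pose N := x ^+ 2 + y ^+ 2.
have N0 : 0 < N.
  rewrite lt_neqAle addr_ge0 ?sqr_ge0// andbT eq_sym paddr_eq0 ?sqr_ge0//.
  by rewrite !sqrf_eq0 negb_and.
pose f (e : R) := (e ^+ t1 * x) ^+ 2 + (e ^+ t2 * y) ^+ 2.
have Df e : exists d, D f e d.
  have di := is_derive_id e (1 : R).
  have Dm n w := drvX 2 (drvM (drvX n di) (is_derive_cst w e (1 : R))).
  by eexists; exact: (drvD (Dm t1 x) (Dm t2 y)).
have cf e : {for e, continuous f} by have [d] := Df e; exact: drv_cont.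
(* With M >= 1 and k >= 1, (M^k)^2 >= M, so that f M >= M N >= 1. *)
pose M : R := 1 + N^-1.
have M1 : 1 <= M by rewrite lerDl invr_ge0 ltW.
have fM : 1 <= f M.
  have MN : 1 <= M * N by rewrite mulrDl mulVf ?gt_eqF// mul1r lerDr ltW.
  have P n w : (0 < n)%N -> M * w ^+ 2 <= (M ^+ n * w) ^+ 2.
    move=> n0; rewrite exprMn ler_wpM2r ?sqr_ge0// -exprM.
    by apply: ler_eXnr => //; rewrite muln_gt0 n0.
  by apply: (le_trans MN); rewrite mulrDr lerD ?P.
have f0 : f 0 = 0 by rewrite /f !expr0n !gtn_eqF// !mul0r expr0n addr0.
have [|e] := IVT_between cf (a := 0) (b := M) (v := 1).
  by rewrite f0 ler01.
move=> [/andP[e0 eM]|/andP[Me e0]]; last first.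
  by have := le_trans M1 (le_trans Me e0); rewrite ler10.
move=> fe.
have {}e0 : 0 < e.
  by rewrite lt_neqAle e0 andbT; apply/eqP => E; move: fe;
    rewrite -E f0 => /esym/eqP; rewrite oner_eq0.
have [th [thpi Ec Es]] := unit_circle_angle fe.
exists e^-1, th; split=> //; first by rewrite invr_gt0.
rewrite /qpolar -Ec -Es !mulrA -!exprMn mulVf ?gt_eqF// !expr1n !mul1r //.
Qed.

Lemma cos_sin_neq0 (th : R) : (cos th, sin th) != 0.
Proof.
apply/eqP => -[c s]; have := cos2Dsin2 th;
  rewrite c s !expr0n addr0 => /esym/eqP.
by rewrite oner_eq0.
Qed.

Lemma qpolar_neq0 rho th : 0 < rho -> qpolar rho th != 0.
Proof.
move=> r0; have := cos_sin_neq0 th; rewrite !xpair_eqE !mulf_eq0 !expf_eq0.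
by rewrite (gt_eqF r0) !andbF.
Qed.

(** * Weighted homogeneous vector fields *)

(** Homogeneity for positive dilations only. It passes to partial derivatives,
    where a factor e^t1 or e^t2 has to be cancelled. *)
Definition pos_qhomog (k : nat) (p : bipoly R) : Prop :=
  forall e x y : R, 0 < e ->
    peval p (e ^+ t1 * x, e ^+ t2 * y) = e ^+ k * peval p (x, y).

Definition pos_qhomog_vfield (r : nat) (F : vfield R) : Prop :=
  pos_qhomog (r + t1) (fstc F) /\ pos_qhomog (r + t2) (sndc F).

(** Euler's identity: differentiate the homogeneity relation in e at e = 1. *)
Lemma pos_qhomog_euler k p : pos_qhomog k p -> forall x y : R,
  t1%:R * x * peval (dx p) (x, y) + t2%:R * y * peval (dy p) (x, y) =
  k%:R * peval p (x, y).
Proof.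
move=> hp x y; have di := drv_id (1 : R).
have Dm n w := drvM (drvX n di) (drv_cst w (1 : R)).
have Dl := peval_drv p (Dm t1 x) (Dm t2 y).
have Dr := drvM (drvX k di) (drv_cst (peval p (x, y)) (1 : R)).
have hnear : \forall e \near (1 : R),
    peval p (e ^+ t1 * x, e ^+ t2 * y) = e ^+ k * peval p (x, y).
  by near=> e; apply: hp; near: e; exact: lt_nbhsr.
have := drv_uniq (drv_near hnear Dl) Dr.
rewrite !expr1n !mul1r !mulr1 !addr0 => <-; ring.
Unshelve. all: by end_near. Qed.

Lemma pos_qhomog_dx k p : pos_qhomog (k + t1) p -> pos_qhomog k (dx p).
Proof.
move=> hp e x y e0; have di := drv_id x.
have Dl := peval_drv p (drvZ (e ^+ t1) di) (drv_cst (e ^+ t2 * y) x).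
have Dr := drvZ (e ^+ (k + t1)) (peval_drv p di (drv_cst y x)).
have := drv_uniq (drv_eq Dl (fun s => hp e s y e0) erefl) Dr.
rewrite !mulr0 !addr0 !mulr1 exprD => E.
by apply: (mulIf (expf_neq0 t1 (lt0r_neq0 e0))); rewrite E mulrAC.
Qed.

Lemma pos_qhomog_dy k p : pos_qhomog (k + t2) p -> pos_qhomog k (dy p).
Proof.
move=> hp e x y e0; have di := drv_id y.
have Dl := peval_drv p (drv_cst (e ^+ t1 * x) y) (drvZ (e ^+ t2) di).
have Dr := drvZ (e ^+ (k + t2)) (peval_drv p (drv_cst x y) di).
have := drv_uniq (drv_eq Dl (fun s => hp e x s e0) erefl) Dr.
rewrite !mulr0 !add0r !mulr1 exprD => E.
by apply: (mulIf (expf_neq0 t2 (lt0r_neq0 e0))); rewrite E mulrAC.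
Qed.

(** The dilation of factor 2 fixes the origin and multiplies p by 2^k > 1. *)
Lemma pos_qhomog_at0 k p : (0 < k)%N -> pos_qhomog k p -> peval p 0 = 0.
Proof.
move=> k0 /(_ 2 0 0 (ltr0Sn _ 1)); rewrite !mulr0 => /eqP.
rewrite -subr_eq0 -{1}[peval p _]mul1r -mulrBl mulf_eq0 => /orP[|/eqP//].
by rewrite subr_eq0 lt_eqF// exprn_egt1 ?ltr1n// -lt0n.
Qed.

Lemma pos_qhomog_vfield_singular r F : pos_qhomog_vfield r F -> singular F 0.
Proof.
case=> hP hQ; split; [apply: (pos_qhomog_at0 _ hP)|apply: (pos_qhomog_at0 _ hQ)].
  by rewrite addn_gt0 t1_gt0 orbT.
by rewrite addn_gt0 t2_gt0 orbT.
Qed.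

(* the wedge D_0 ^ F *)
Definition wedge (F : vfield R) (z : R * R) : R :=
  t1%:R * z.1 * peval (sndc F) z - t2%:R * z.2 * peval (fstc F) z.

Definition divergence (F : vfield R) (z : R * R) : R :=
  peval (dx (fstc F)) z + peval (dy (sndc F)) z.

(** The relation w' = (div F) w. Both sides differ by
    P (E(Q) - (r + t2) Q) - Q (E(P) - (r + t1) P), where E is the Euler operator
    t1 x d/dx + t2 y d/dy, and this vanishes by Euler's identity. *)
Lemma wedge_drv r F g t : pos_qhomog_vfield r F ->
  D (fun s => (g s).1) t (peval (fstc F) (g t)) ->
  D (fun s => (g s).2) t (peval (sndc F) (g t)) ->
  D (fun s => wedge F (g s)) t (divergence F (g t) * wedge F (g t)).
Proof.
move=> [hP hQ] D1 D2.
have e w : w = (w.1, w.2) :> R * R by case: w.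
have DP := peval_drv (fstc F) D1 D2; have DQ := peval_drv (sndc F) D1 D2.
have DW := drvB (drvM (drvZ t1%:R D1) DQ) (drvM (drvZ t2%:R D2) DP).
apply: (drv_eq DW) => [s|].
  by rewrite /wedge -!e.
have := pos_qhomog_euler hP (g t).1 (g t).2;
  have := pos_qhomog_euler hQ (g t).1 (g t).2.
rewrite /wedge /divergence -!e !natrD.
move: (peval (dx (fstc F)) (g t)) (peval (dy (fstc F)) (g t))
 (peval (dx (sndc F)) (g t)) (peval (dy (sndc F)) (g t)) (peval (fstc F) (g t))
 (peval (sndc F) (g t)) => Px Py Qx Qy P Q eQ eP.
apply/eqP; rewrite -subr_eq0; apply/eqP.
transitivity
  (P * (t1%:R * (g t).1 * Qx + t2%:R * (g t).2 * Qy - (r%:R + t2%:R) * Q)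
   - Q * (t1%:R * (g t).1 * Px + t2%:R * (g t).2 * Py - (r%:R + t1%:R) * P)).
  by ring.
by rewrite eP eQ !subrr !mulr0 subrr.
Qed.

Lemma hamiltonian_pos_qhomog r h : pos_qhomog (r + (t1 + t2)) h ->
  pos_qhomog_vfield r (hamiltonian h).
Proof.
move=> hh; split=> /=; last by apply: pos_qhomog_dx; rewrite addnAC -addnA.
have := @pos_qhomog_dy (r + t1) h; rewrite -addnA => /(_ hh) hd e x y e0.
by rewrite !pevalN hd// mulrN.
Qed.

(** Euler's identity for h again. Together with [conservative_part_wedge] this
    shows that F and X_h, for h the conservative part of F, have the same wedge
    product with D_0. *)
Lemma hamiltonian_wedge k h : pos_qhomog k h -> forall z : R * R,
  wedge (hamiltonian h) z = k%:R * peval h z.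
Proof.
move=> hh [x y]; rewrite -(pos_qhomog_euler hh) /wedge /= pevalN.
by rewrite mulrN opprK.
Qed.

Lemma conservative_part_wedge r F z :
  wedge F z = (r + (t1 + t2))%:R * peval (conservative_part t1 t2 r F) z.
Proof.
rewrite /conservative_part pevalZ mulrA divff ?mul1r; last first.
  by rewrite pnatr_eq0 -lt0n !addn_gt0 t1_gt0 orbT.
by rewrite pevalB !pevalM !peval_nat peval_varx peval_vary.
Qed.

Lemma conservative_part_pos_qhomog r F : pos_qhomog_vfield r F ->
  pos_qhomog (r + (t1 + t2)) (conservative_part t1 t2 r F).
Proof.
move=> [hP hQ] e x y e0.
rewrite /conservative_part !pevalZ !pevalB !pevalM !peval_nat !peval_varx
  !peval_vary /=.
by rewrite hP// hQ// !exprD; ring.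
Qed.

(** * Zeros of the wedge product prevent rotation *)

(** The key obstruction: an orbit on which w vanishes at one point stays in one
    open quadrant or open half-axis. First w = 0 along the orbit, by w' = (div F)
    w; then F = nu D_0 there, which gives one linear equation for each
    coordinate. *)
Lemma wedge0_quadrant r F (g : R -> R * R) (T : R) : pos_qhomog_vfield r F ->
  0 <= T -> solution_on F `[0, T] g ->
  (forall t, 0 <= t <= T -> g t != 0) -> wedge F (g 0) = 0 ->
  forall t, 0 <= t <= T -> exists c1 c2,
    [/\ 0 < c1, 0 < c2 & g t = (c1 * (g 0).1, c2 * (g 0).2)].
Proof.
move=> hF T0 sol g0 w0.
have e w : w = (w.1, w.2) :> R * R by case: w.
have Dg t : 0 <= t <= T -> D (fun s => (g s).1) t (peval (fstc F) (g t)) /\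
    D (fun s => (g s).2) t (peval (sndc F) (g t)).
  by move=> tT; apply: sol; rewrite /= in_itv.
have Dp p t : 0 <= t <= T -> exists d, D (fun s => peval p (g s)) t d.
  move=> /Dg[D1 D2]; eexists; apply: (drv_eq (peval_drv p D1 D2)) => [s|//].
  by rewrite -e.
have [K HK] : exists K, forall t, 0 <= t <= T -> `|divergence F (g t)| <= K.
  apply: drv_bounded => // t tT.
  have [a Da] := Dp (dx (fstc F)) t tT; have [b Db] := Dp (dy (sndc F)) t tT.
  by eexists; exact: drvD Da Db.
have wt t : 0 <= t <= T -> wedge F (g t) = 0.
  move=> tT; have [s sT|c _ ->] :=
      linear_ode_sign (u := fun s => wedge F (g s)) _ HK tT.
    by have [D1 D2] := Dg s sT; exact: wedge_drv hF D1 D2.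
  by rewrite w0 mulr0.
(* Where t1 x Q = t2 y P, the factor of proportionality between F and D_0 is
   nu = (x P + y Q) / (t1 x^2 + t2 y^2). *)
pose N (t : R) := t1%:R * (g t).1 ^+ 2 + t2%:R * (g t).2 ^+ 2.
have Nt t : 0 <= t <= T -> N t != 0.
  move=> /g0; rewrite /N [g t]e xpair_eqE negb_and /= => gt.
  have ge0 (k : nat) (w : R) : 0 <= k%:R * w ^+ 2 by rewrite mulr_ge0// sqr_ge0.
  by rewrite paddr_eq0// !mulf_eq0 !pnatr_eq0 !gtn_eqF//= !orbb negb_and.
pose nu (t : R) :=
  ((g t).1 * peval (fstc F) (g t) + (g t).2 * peval (sndc F) (g t)) / N t.
have [L HL] : exists L, forall t, 0 <= t <= T -> `|nu t| <= L.
  apply: drv_bounded => // t tT; have [D1 D2] := Dg t tT.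
  have [a Da] := Dp (fstc F) t tT; have [b Db] := Dp (sndc F) t tT.
  have DN := drvD (drvZ t1%:R (drvX 2 D1)) (drvZ t2%:R (drvX 2 D2)).
  eexists; exact: drvM (drvD (drvM D1 Da) (drvM D2 Db)) (drvV DN (Nt t tT)).
have HLk (k : nat) t : 0 <= t <= T -> `|k%:R * nu t| <= k%:R * L.
  by move=> tT; rewrite normrM normr_nat ler_wpM2l// HL.
have Ew t : 0 <= t <= T ->
    t1%:R * (g t).1 * peval (sndc F) (g t) = t2%:R * (g t).2 * peval (fstc F) (g t).
  by move=> /wt/eqP; rewrite subr_eq0 => /eqP.
move=> t tT.
have [s sT|c1 c1_gt0 E1] :=
    linear_ode_sign (u := fun s => (g s).1) _ (HLk t1) tT.
  have [D1 _] := Dg s sT; apply: (drv_eq D1) => //.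
  rewrite /nu mulrA -mulrA [_^-1 * _]mulrC mulrA;
    apply/esym/(canLR (mulfK (Nt s sT))).
  rewrite mulrDr mulrDl [t1%:R * (_.2 * _)]mulrCA -mulrA.
  transitivity (t1%:R * (g s).1 ^+ 2 * peval (fstc F) (g s) +
    (g s).2 * (t1%:R * (g s).1 * peval (sndc F) (g s))); first by ring.
  by rewrite Ew// /N; ring.
have [s sT|c2 c2_gt0 E2] :=
    linear_ode_sign (u := fun s => (g s).2) _ (HLk t2) tT.
  have [_ D2] := Dg s sT; apply: (drv_eq D2) => //.
  rewrite /nu mulrA -mulrA [_^-1 * _]mulrC mulrA;
    apply/esym/(canLR (mulfK (Nt s sT))).
  transitivity (t2%:R * (g s).2 ^+ 2 * peval (sndc F) (g s) +
    (g s).1 * (t2%:R * (g s).2 * peval (fstc F) (g s))); first by ring.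
  by rewrite -Ew// /N; ring.
by exists c1, c2; split=> //; rewrite -E1 -E2 -e.
Qed.

Lemma quadrant_antipode (p : R * R) (c1 c2 s : R) :
  p != 0 -> 0 < c1 -> 0 < c2 -> 0 <= s ->
  (c1 * p.1, c2 * p.2) <> (- s * p.1, - s * p.2).
Proof.
move=> p0 c10 c20 s0 [/eqP + /eqP].
rewrite -subr_eq0 -mulrBl mulf_eq0 => E1;
  rewrite -subr_eq0 -mulrBl mulf_eq0 => E2.
have n1 : (c1 - - s == 0) = false by apply/gt_eqF; lra.
have n2 : (c2 - - s == 0) = false by apply/gt_eqF; lra.
case: p p0 E1 E2 => x y /=; rewrite n1 n2 xpair_eqE /= negb_and.
by case: (x == 0); case: (y == 0).
Qed.

(** The weighted dilates of q accumulate at the origin, so any property of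
    points near the origin holds at one of them. *)
Lemma near0_dilate (P : set (R * R)) (q : R * R) :
  (\forall p \near (0 : R * R)^', P p) -> q != 0 ->
  exists2 e, 0 < e & P (e ^+ t1 * q.1, e ^+ t2 * q.2).
Proof.
move=> nP q0; pose f (e : R) := (e ^+ t1 * q.1, e ^+ t2 * q.2).
have f0 : f 0 = 0 by rewrite /f !expr0n !gtn_eqF// !mul0r.
have cf : f e @[e --> (0 : R)] --> (0 : R * R).
  rewrite -[X in _ --> X]f0.
  have c k w : (fun e : R => e ^+ k * w) e @[e --> (0 : R)] --> 0 ^+ k * w.
    exact: (drv_cont (drvM (drvX k (drv_id 0)) (drv_cst w 0))).
  exact: (cvg_pair (c t1 q.1) (c t2 q.2)).
move: nP; rewrite near_withinE => /cf nP.
near ((0 : R)^'+) => e.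
have e0 : 0 < e by near: e; exact: nbhs_right_gt.
exists e => //; have : f e != 0 -> P (f e).
  by near: e; apply: (@cvg_at_right_filter _ _ id 0 _ ); [exact: cvg_id|].
apply; rewrite /f xpair_eqE !mulf_eq0 !expf_eq0 (gt_eqF e0) !andbF /=.
by rewrite -xpair_eqE -surjective_pairing.
Unshelve. all: by end_near. Qed.

Lemma wedge_dilate r F (q : R * R) e : pos_qhomog_vfield r F -> 0 < e ->
  wedge F q = 0 -> wedge F (e ^+ t1 * q.1, e ^+ t2 * q.2) = 0.
Proof.
case: q => x y [hP hQ] e0 w0; rewrite /wedge /= hP// hQ//.
transitivity (e ^+ (r + t1 + t2) * wedge F (x, y)); last by rewrite w0 mulr0.
by rewrite /wedge /= !exprD; ring.
Qed.

(** A variation of the angle by 2 pi passes through the value th(0) + pi or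
    th(0) - pi. *)
Lemma full_turn_antipode (T : R) (g : R -> R * R) : 0 < T -> full_turn T g ->
  exists2 t, 0 <= t <= T &
    exists2 s, 0 <= s & g t = (- s * (g 0).1, - s * (g 0).2).
Proof.
move=> T0 [rho [th [cth pol E]]].
have [c cT Ec] : exists2 c, c \in `[0, T] &
    th c = th 0 + pi \/ th c = th 0 - pi.
  have pi0 := pi_gt0 R.
  case: (leP 0 (th T - th 0)) => d0; move: E.
    rewrite ger0_norm// => E.
    have [|c cT Ec] := IVT (ltW T0) cth (v := th 0 + pi);
      last by exists c => //; left.
    by rewrite ge_min le_max; apply/andP; split; apply/orP; [left|right]; lra.
  rewrite ltr0_norm// => E.
  have [|c cT Ec] := IVT (ltW T0) cth (v := th 0 - pi);
    last by exists c => //; right.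
  by rewrite ge_min le_max; apply/andP; split; apply/orP; [right|left]; lra.
exists c; first by move: cT; rewrite in_itv.
have [r0 g0] : 0 < rho 0 /\ g 0 = (rho 0 * cos (th 0), rho 0 * sin (th 0)).
  by apply: pol; rewrite in_itv /= lexx ltW.
have [rc gc] := pol c cT.
exists (rho c / rho 0); first by rewrite divr_ge0 ?ltW.
have [Ecos Esin] : cos (th c) = - cos (th 0) /\ sin (th c) = - sin (th 0).
  case: Ec => ->; first by rewrite cosDpi sinDpi.
  by rewrite -[in - cos _](subrK pi (th 0)) -[in - sin _](subrK pi (th 0))
    cosDpi sinDpi !opprK.
rewrite gc g0 Ecos Esin /= !mulNr !mulrA !divfK ?gt_eqF// !mulrN //.
Qed.

(** The full turn provided by monodromy contradicts [wedge0_quadrant], for a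
    starting point that is a dilate of a zero of w. The neighborhood that the
    orbit must not leave is here the whole plane. *)
Lemma monodromic_wedge_neq0 r F (q : R * R) : pos_qhomog_vfield r F ->
  monodromic_at_origin F -> q != 0 -> wedge F q != 0.
Proof.
move=> hF [_ /(_ setT (filterT))] mono q0; apply/eqP => w0.
have [e e0 [T [g [T0 sol g0 _ turn]]]] := near0_dilate mono q0.
have [t tT [s s0 gt]] := full_turn_antipode T0 turn.
have gn0 u : 0 <= u <= T -> g u != 0.
  move=> uT; case: turn => rho [th [_ /(_ u) + _]].
  rewrite in_itv => /(_ uT) [ru ->].
  have := cos_sin_neq0 (th u); rewrite !xpair_eqE !mulf_eq0.
  by rewrite (gt_eqF ru).
have wg0 : wedge F (g 0) = 0 by rewrite g0; exact: wedge_dilate hF e0 w0.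
have [c1 [c2 [c10 c20]]] := wedge0_quadrant hF (ltW T0) sol gn0 wg0 tT.
rewrite gt => /esym; apply: quadrant_antipode => //.
by apply: gn0; rewrite lexx ltW.
Qed.

(** A ray from the origin that avoids A lies in the component of the origin,
    which is therefore unbounded. *)
Lemma unbounded_ray (A : set (R * R)) (p : R * R) : p != 0 ->
  (forall s, 0 <= s -> ~ A (- s * p.1, - s * p.2)) -> ~ surrounds_origin A.
Proof.
move=> p0 An [A0 bd].
pose ray := (fun k : R => k *: p) @` `]-oo, 0].
have cray : connected ray.
  apply: connected_continuous_connected.
    by apply/connected_intervalP; exact: interval_is_interval.
  by apply: continuous_subspaceT; exact: scalel_continuous.
have ray_comp : ray `<=` connected_component (~` A) 0.
  apply: connected_component_max => //.
    by exists 0; rewrite ?scale0r//= in_itv /= lexx.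
  move=> z [k /=]; rewrite in_itv /= => k0 <-.
  by have := An (- k); rewrite opprK; apply; rewrite oppr_ge0.
rewrite /= /bounded_near in bd.
have [M [_ HM]] := bd.
pose K := `|M| + 1.
have pn : 0 < `|p| by rewrite normr_gt0.
have MK : M < K by rewrite ltr_pwDr// ler_norm.
have := HM _ MK (- ((K + 1) / `|p|) *: p).
have K0 : 0 <= (K + 1) / `|p| by rewrite divr_ge0// /K !addr_ge0.
have rayp : ray (- ((K + 1) / `|p|) *: p).
  by exists (- ((K + 1) / `|p|)) => //=; rewrite in_itv /= oppr_le0.
move=> /(_ (ray_comp _ rayp));
  rewrite /= normrZ normrN ger0_norm// divfK ?gt_eqF//.
by rewrite leNgt ltrDl ltr01.
Qed.

Lemma center_wedge_neq0 r F (q : R * R) : pos_qhomog_vfield r F ->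
  center_at_origin F -> q != 0 -> wedge F q != 0.
Proof.
move=> hF [_ cen] q0; apply/eqP => w0.
have [e e0 [g [[sol [T T0 gT] _] g0 sur]]] := near0_dilate cen q0.
have [gA _] := sur.
have gn0 t : g t != 0 by apply/eqP => E; apply: gA; exists t.
move: sur; apply: (@unbounded_ray _ (g 0)) => // s s0 [t _ gt].
(* [wedge0_quadrant] speaks of the future only; by periodicity the point g t is
   also met at a nonnegative time. *)
have [n tn] := ge0_shift t T0.
have wg0 : wedge F (g 0) = 0 by rewrite g0; exact: wedge_dilate hF e0 w0.
have sol' : solution_on F `[0, t + n%:R * T] g by move=> u _; exact: sol.
have [|c1 [c2 [c10 c20]]] :=
  wedge0_quadrant hF tn sol' (fun u _ => gn0 u) wg0 (t := t + n%:R * T).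
  by rewrite tn lexx.
by rewrite (periodicn gT) gt => /esym; exact: quadrant_antipode.
Qed.

(** * Explicit orbits where the wedge product does not vanish *)
Section Orbit.
Variables (r : nat) (F : vfield R).
Hypotheses (hF : pos_qhomog_vfield r F).
Hypothesis (wF : forall q : R * R, q != 0 -> wedge F q != 0).

(** Along an orbit written as (rho^t1 cos th, rho^t2 sin th) this is
    (d rho / d th) / rho: it is a function of th alone. *)
Definition radial_rate (th : R) : R :=
  (cos th * peval (fstc F) (cos th, sin th) +
   sin th * peval (sndc F) (cos th, sin th)) / wedge F (cos th, sin th).

(** The derivative d t / d th along an orbit, multiplied by rho^r. *)
Definition time_rate (th : R) : R :=
  (t1%:R * cos th ^+ 2 + t2%:R * sin th ^+ 2) / wedge F (cos th, sin th).

Lemma circle_wedge_neq0 th : wedge F (cos th, sin th) != 0.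
Proof. exact/wF/cos_sin_neq0. Qed.

Lemma circle_drv p (th : R) :
  exists d, D (fun th => peval p (cos th, sin th)) th d.
Proof.
by eexists; exact: (peval_drv p (is_derive_cos th) (is_derive_sin th)).
Qed.

Lemma circle_wedge_drv (th : R) :
  exists d, D (fun th => wedge F (cos th, sin th)) th d.
Proof.
have [a Da] := circle_drv (fstc F) th; have [b Db] := circle_drv (sndc F) th.
eexists; exact: (drvB (drvM (drvZ t1%:R (is_derive_cos th)) Db)
                      (drvM (drvZ t2%:R (is_derive_sin th)) Da)).
Qed.

Lemma radial_rate_drv th : exists d, D radial_rate th d.
Proof.
have [a Da] := circle_drv (fstc F) th; have [b Db] := circle_drv (sndc F) th.
have [w Dw] := circle_wedge_drv th.
have DN := drvD (drvM (is_derive_cos th) Da) (drvM (is_derive_sin th) Db).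
eexists; exact: (drvM DN (drvV Dw (circle_wedge_neq0 th))).
Qed.

Lemma time_rate_drv th : exists d, D time_rate th d.
Proof.
have [w Dw] := circle_wedge_drv th.
have DN := drvD (drvZ t1%:R (drvX 2 (is_derive_cos th)))
                (drvZ t2%:R (drvX 2 (is_derive_sin th))).
eexists; exact: (drvM DN (drvV Dw (circle_wedge_neq0 th))).
Qed.

Lemma weighted_circle_gt0 (a b : nat) (th : R) : (0 < a)%N -> (0 < b)%N ->
  0 < a%:R * cos th ^+ 2 + b%:R * sin th ^+ 2.
Proof.
move=> a0 b0.
have le_mul (n : nat) (x : R) : (0 < n)%N -> x ^+ 2 <= n%:R * x ^+ 2.
  move=> n0; have n1 : (1 : R) <= n%:R by rewrite ler1n.
  by have := sqr_ge0 x; nra.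
apply: (@lt_le_trans _ _ 1) => //; rewrite -[leLHS](cos2Dsin2 th).
exact: (lerD (le_mul _ _ a0) (le_mul _ _ b0)).
Qed.

Lemma time_rate_neq0 th : time_rate th != 0.
Proof.
by rewrite mulf_neq0 ?invr_eq0 ?circle_wedge_neq0// gt_eqF//
  weighted_circle_gt0.
Qed.

(** This identity and the next one express that [radial_rate] and [time_rate]
    solve the linear system obtained by writing F in weighted polar coordinates
    and dividing by the powers of rho. *)
Lemma fstc_on_circle th :
  t1%:R * radial_rate th * cos th - sin th =
  time_rate th * peval (fstc F) (cos th, sin th).
Proof.
rewrite /radial_rate /time_rate; have := circle_wedge_neq0 th;
  rewrite /wedge /=.
by move=> w0; field.
Qed.

Lemma sndc_on_circle th :
  t2%:R * radial_rate th * sin th + cos th =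
  time_rate th * peval (sndc F) (cos th, sin th).
Proof.
rewrite /radial_rate /time_rate; have := circle_wedge_neq0 th;
  rewrite /wedge /=.
by move=> w0; field.
Qed.

Lemma radial_antiderivative :
  exists K : R -> R, forall th, D K th (radial_rate th).
Proof.
have cr : continuous radial_rate.
  by move=> th; have [d] := radial_rate_drv th; exact: drv_cont.
exact: antiderivative.
Qed.

Variable K : R -> R.
Hypothesis DK : forall th, D K th (radial_rate th).

Section FromPoint.
Variables (rho0 th0 : R).
Hypothesis rho0_gt0 : 0 < rho0.

Definition orbit_radius (th : R) := rho0 * expR (K th - K th0).
Definition orbit_speed (th : R) := time_rate th / orbit_radius th ^+ r.
Definition orbit_curve (th : R) := qpolar (orbit_radius th) th.

Lemma orbit_radius0 : orbit_radius th0 = rho0.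
Proof. by rewrite /orbit_radius subrr expR0 mulr1. Qed.

Lemma orbit_radius_gt0 th : 0 < orbit_radius th.
Proof. by rewrite mulr_gt0 ?expR_gt0. Qed.

Lemma orbit_radius_drv th :
  D orbit_radius th (radial_rate th * orbit_radius th).
Proof.
have DKB := drvB (DK th) (drv_cst (K th0) th).
apply: (drv_eq (drvZ rho0 (drv_comp (is_derive_expR _) DKB))) => //.
by rewrite /orbit_radius subr0; ring.
Qed.

Lemma orbit_speed_neq0 th : orbit_speed th != 0.
Proof.
by rewrite mulf_neq0 ?time_rate_neq0// invr_eq0 expf_neq0// gt_eqF//
  orbit_radius_gt0.
Qed.

Lemma orbit_speed_continuous : continuous orbit_speed.
Proof.
move=> th; have [d Dd] := time_rate_drv th.
have rn : orbit_radius th ^+ r != 0.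
  by rewrite expf_neq0// gt_eqF// orbit_radius_gt0.
exact: (drv_cont (drvM Dd (drvV (drvX r (orbit_radius_drv th)) rn))).
Qed.

Let rad_power_drv n th : D (fun u => orbit_radius u ^+ n) th
  (n%:R * radial_rate th * orbit_radius th ^+ n).
Proof.
apply: (drv_eq (drvX n (orbit_radius_drv th))) => //; case: n => [|n];
  first by rewrite !mul0r.
by rewrite /= exprS; ring.
Qed.

(** The curve is tangent to F, with d t / d th = [orbit_speed]. *)
Lemma orbit_curve_drv th :
  D (fun u => (orbit_curve u).1) th
    (orbit_speed th * peval (fstc F) (orbit_curve th)) /\
  D (fun u => (orbit_curve u).2) th
    (orbit_speed th * peval (sndc F) (orbit_curve th)).
Proof.
have [hP hQ] := hF; have rn := gt_eqF (orbit_radius_gt0 th).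
rewrite /orbit_curve /qpolar hP ?orbit_radius_gt0// hQ ?orbit_radius_gt0//.
have E n (x : R) : orbit_speed th * (orbit_radius th ^+ (r + n) * x) =
    orbit_radius th ^+ n * (time_rate th * x).
  by rewrite /orbit_speed exprD; field; rewrite expf_neq0// rn.
rewrite !E -fstc_on_circle -sndc_on_circle; split.
  by apply: (drv_eq (drvM (rad_power_drv t1 th) (is_derive_cos th))) => //;
    ring.
by apply: (drv_eq (drvM (rad_power_drv t2 th) (is_derive_sin th))) => //; ring.
Qed.

(** Time Tm is an antiderivative of [orbit_speed], and Th is its inverse, so
    [orbit_curve] composed with Th solves the equation. Only times in the range
    of Tm are considered: an orbit may reach infinity, or the origin, before
    its time exhausts the line. *)
Lemma orbit_solution : exists Tm Th : R -> R,
  [/\ Tm th0 = 0, forall th, D Tm th (orbit_speed th), cancel Tm Th,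
      forall th, D Th (Tm th) (orbit_speed th)^-1 &
      forall th,
        D (fun t => (orbit_curve (Th t)).1) (Tm th)
          (peval (fstc F) (orbit_curve th)) /\
        D (fun t => (orbit_curve (Th t)).2) (Tm th)
          (peval (sndc F) (orbit_curve th))].
Proof.
have [G DG] := antiderivative orbit_speed_continuous.
pose Tm th := G th - G th0.
have DTm th : D Tm th (orbit_speed th).
  by apply: (drv_eq (drvB (DG th) (drv_cst (G th0) th))) => //; rewrite subr0.
have [Th ThK DTh] := drv_inverse DTm orbit_speed_neq0.
exists Tm, Th; split=> // [|th]; first exact: subrr.
have [D1 D2] := orbit_curve_drv th.
have cancel_speed (x : R) : orbit_speed th * x * (orbit_speed th)^-1 = x.
  by rewrite mulrAC (mulfV (orbit_speed_neq0 th)) mul1r.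
rewrite -[X in is_derive X _ _ _]ThK in D1;
  rewrite -[X in is_derive X _ _ _]ThK in D2.
split; first exact: (drv_eq (drv_comp D1 (DTh th)) _ (cancel_speed _)).
exact: (drv_eq (drv_comp D2 (DTh th)) _ (cancel_speed _)).
Qed.
End FromPoint.
End Orbit.

(** * From the weighted angle to the polar angle *)

(** An ordinary polar angle of (rho^t1 cos th, rho^t2 sin th), that is, of
    (cos th, k sin th) with k = rho^(t2 - t1): rotated by - th, this vector
    becomes (cos^2 th + k sin^2 th, (k - 1) sin th cos th), whose first component
    is positive, so that its angle is an arctangent. *)
Definition polar_angle (rho th : R) : R := let k := rho ^+ (t2 - t1) in
  th + atan ((k - 1) * sin th * cos th / (cos th ^+ 2 + k * sin th ^+ 2)).

Lemma squeezed_circle_gt0 (k th : R) : 0 < k ->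
  0 < cos th ^+ 2 + k * sin th ^+ 2.
Proof.
move=> k0; have c2 := sqr_ge0 (cos th); have s2 := sqr_ge0 (sin th).
rewrite lt_neqAle eq_sym addr_ge0 ?(mulr_ge0 (ltW k0) s2)// andbT.
rewrite paddr_eq0 ?(mulr_ge0 (ltW k0) s2)// [k * _ == 0]mulf_eq0 (gt_eqF k0)
  !sqrf_eq0 /=.
by have := cos_sin_neq0 th; rewrite xpair_eqE.
Qed.

Lemma polar_angle_near (rho th : R) : `|polar_angle rho th - th| < pi / 2.
Proof.
by rewrite /polar_angle addrAC subrr add0r ltr_norml atan_gtNpi2 atan_ltpi2.
Qed.

Lemma polar_angleP (rho th : R) : 0 < rho -> exists2 N, 0 < N &
  qpolar rho th = (N * cos (polar_angle rho th), N * sin (polar_angle rho th)).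
Proof.
move=> rho0; rewrite /polar_angle /=; set k := rho ^+ (t2 - t1).
have k0 : 0 < k by rewrite exprn_gt0.
have q0 := squeezed_circle_gt0 th k0; set q := _ + k * _ in q0 *.
set a := atan _.
have ca : 0 < cos a by rewrite cos_gt0_pihalf// atan_gtNpi2 atan_ltpi2.
have Et : sin a = (k - 1) * sin th * cos th / q * cos a.
  by rewrite -[X in _ = X * _]atanK -/a /tan divfK// gt_eqF.
exists (rho ^+ t1 * q / cos a);
  first by rewrite divr_gt0// mulr_gt0// exprn_gt0.
have Ek : rho ^+ t2 = rho ^+ t1 * k by rewrite -exprD subnKC.
have cs := cos2Dsin2 th; have nq := lt0r_neq0 q0; have nc := lt0r_neq0 ca.
rewrite /qpolar Ek cosD sinD Et; congr (_, _).
  transitivity (rho ^+ t1 * cos th * (cos th ^+ 2 + sin th ^+ 2));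
    first by rewrite cs mulr1.
  have -> : cos th ^+ 2 + sin th ^+ 2 = q - (k - 1) * sin th ^+ 2.
    by rewrite /q; ring.
  by field; rewrite nq nc.
transitivity (rho ^+ t1 * (k * sin th * (cos th ^+ 2 + sin th ^+ 2))).
  by rewrite cs mulr1 mulrA.
have -> : k * sin th * (cos th ^+ 2 + sin th ^+ 2) =
    sin th * q + (k - 1) * sin th * cos th ^+ 2.
  by rewrite /q; ring.
by field; rewrite nq nc.
Qed.

Lemma polar_angle_drv (rho : R -> R) th d : 0 < rho th -> D rho th d ->
  exists e, D (fun u => polar_angle (rho u) u) th e.
Proof.
move=> r0 Dr.
have q0 := lt0r_neq0 (squeezed_circle_gt0 th (exprn_gt0 (t2 - t1) r0)).
have Dk := drvX (t2 - t1) Dr; have Ds := is_derive_sin th;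
  have Dc := is_derive_cos th.
have DQ := drvD (drvX 2 Dc) (drvM Dk (drvX 2 Ds)).
have DV := drvV DQ q0.
have DN := drvM (drvM (drvB Dk (drv_cst 1 th)) Ds) Dc.
eexists; exact: (drvD (drv_id th) (drv_comp (is_derive1_atan _) (drvM DN DV))).
Qed.

(** One of |cos th|, |sin th| is at least 1 / 2, so that a point with
    rho >= eta has a coordinate of size at least eta^(t1 + t2) / 2. *)
Lemma qpolar_small (eta rho th : R) : 0 < eta -> eta <= 1 -> 0 < rho ->
  `|(qpolar rho th).1| < eta ^+ (t1 + t2) / 2 ->
  `|(qpolar rho th).2| < eta ^+ (t1 + t2) / 2 -> rho < eta.
Proof.
move=> e0 e1 r0; rewrite /qpolar /= !normrM !normrX (gtr0_norm r0) => H1 H2.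
rewrite ltNge; apply/negP => er.
have P (k : nat) : (k <= t1 + t2)%N -> eta ^+ (t1 + t2) <= rho ^+ k.
  move=> kt; apply: (@le_trans _ _ (eta ^+ k));
    first by rewrite ler_wiXn2l// ltW.
  by rewrite lerXn2r// nnegrE ltW.
have p1 := P t1 (leq_addr _ _); have p2 := P t2 (leq_addl _ _).
have n0 := exprn_gt0 (t1 + t2) e0.
have c1 : `|cos th| < 1 / 2.
  rewrite ltNge; apply/negP => c; move: H1; rewrite ltNge => /negP; apply.
  by apply: ler_pM => //; [exact: ltW | rewrite -div1r].
have s1 : `|sin th| < 1 / 2.
  rewrite ltNge; apply/negP => c; move: H2; rewrite ltNge => /negP; apply.
  by apply: ler_pM => //; [exact: ltW | rewrite -div1r].
have := cos2Dsin2 th.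
rewrite -(real_normK (num_real (cos th))) -(real_normK (num_real (sin th))).
have := normr_ge0 (cos th); have := normr_ge0 (sin th); nra.
Qed.

Lemma qpolar_le (rho eta th : R) : 0 < rho -> rho < eta -> eta <= 1 ->
  `|(qpolar rho th).1| < eta /\ `|(qpolar rho th).2| < eta.
Proof.
move=> r0 re e1.
have P (k : nat) (x : R) : (0 < k)%N -> `|x| <= 1 -> `|rho ^+ k * x| < eta.
  move=> k0 x1; apply: (le_lt_trans _ re); rewrite normrM normrX gtr0_norm//.
  rewrite -[leRHS]mulr1; apply: ler_pM => //; first exact: exprn_ge0 (ltW r0).
  by apply: ler_iXnr => //; [exact: ltW | exact: le_trans (ltW re) e1].
by split; apply: P => //; rewrite ?cos_max ?sin_max// ler_norml ?cos_geN1
  ?cos_le1 ?sin_geN1 ?sin_le1.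
Qed.

Section Monodromic.

Variables (r : nat) (F : vfield R).
Hypotheses (hF : pos_qhomog_vfield r F).
Hypothesis (wF : forall q : R * R, q != 0 -> wedge F q != 0).

(** Starting from rho0 and th0, the orbit is followed until th has varied by
    3 pi, in the direction in which time increases. The polar angle then has
    varied by more than 3 pi - 2 (pi / 2) = 2 pi, and an earlier time at which it
    has varied by exactly 2 pi is found by continuity. *)
Lemma wedge_neq0_monodromic : monodromic_at_origin F.
Proof.
split; first exact: pos_qhomog_vfield_singular hF.
move=> V /nbhs_ballP[delta /= delta0 deltaV].
have [K DK] := radial_antiderivative wF.
have pi0 := pi_gt0 R.
(* The initial angle is at most pi in absolute value, and it varies by at most
   3 pi; so rho varies at most by the factor exp (2 B). *)
have [B HB] : exists B, forall th, - (4 * pi) <= th <= 4 * pi -> `|K th| <= B.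
  by apply: drv_bounded => [|th _]; [lra | exists (radial_rate F th)].
have B0 : 0 <= B by apply: le_trans (HB 0 _); [exact: normr_ge0 | lra].
pose e := Num.min 1 delta.
have e0 : 0 < e by rewrite lt_min ltr01.
have e1 : e <= 1 by rewrite ge_min lexx.
have ed : e <= delta by rewrite ge_min lexx orbT.
pose eta := e * expR (- (2 * B)).
have eta0 : 0 < eta by rewrite mulr_gt0 ?expR_gt0.
have eta1 : eta <= 1.
  by rewrite -[leRHS]mulr1 ler_pM ?expR_ge0 ?(ltW e0)// -[leRHS]expR0
    ler_expR; lra.
rewrite near_withinE; apply/nbhs_ballP.
exists (eta ^+ (t1 + t2) / 2) => /=; first by rewrite divr_gt0 ?exprn_gt0.
move=> p [b1 b2] pn0.
have [rho0 [th0 [r0 thpi Ep]]] := qpolar_surj pn0.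
have rho_small : rho0 < eta.
  apply: (qpolar_small eta0 eta1 r0 (th := th0)).
    by move: b1; rewrite /ball /= sub0r normrN Ep.
  by move: b2; rewrite /ball /= sub0r normrN Ep.
have [Tm [Th [Tm0 DTm ThK DTh Dg]]] := orbit_solution hF wF DK th0 r0.
set rad := orbit_radius K rho0 th0 in DTm DTh Dg *.
set crv := orbit_curve K rho0 th0 in DTm DTh Dg *.
set spd := orbit_speed r F K rho0 th0 in DTm DTh Dg *.
have rad0 th : 0 < rad th by exact: orbit_radius_gt0.
have cTm x : {for x, continuous Tm} by exact: drv_cont (DTm x).
(* The sign of the speed decides in which direction the orbit turns. *)
have [th1 d1 T1] : exists2 th1,
    th1 = th0 + 3 * pi \/ th1 = th0 - 3 * pi & 0 < Tm th1.
  have [sp|sp] : (forall x, 0 < spd x) \/ (forall x, spd x < 0).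
    apply: nonvanishing_sign => x; last exact: orbit_speed_neq0.
    exact: orbit_speed_continuous.
    exists (th0 + 3 * pi); first by left.
    have [|c _] := @drv_MVT _ Tm spd th0 (th0 + 3 * pi) _ (fun x _ => DTm x);
      first by lra.
    by rewrite Tm0 subr0 => ->; rewrite mulr_gt0//; lra.
  exists (th0 - 3 * pi); first by right.
  have [|c _] := @drv_MVT _ Tm spd (th0 - 3 * pi) th0 _ (fun x _ => DTm x);
    first by lra.
  rewrite Tm0 sub0r => E; rewrite -oppr_lt0 E nmulr_rlt0//; lra.
(* Times between 0 and Tm th1 correspond to angles between th0 and th1. *)
have hit t : 0 <= t <= Tm th1 -> exists2 th, `|th - th0| <= 3 * pi & Tm th = t.
  move=> tT.
  have [|th thb <-] := IVT_between cTm (a := th0) (b := th1) (v := t).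
    by rewrite Tm0.
  exists th => //; rewrite ler_norml; case: d1 thb => -> [] /andP[] *; lra.
pose psi t := polar_angle (rad (Th t)) (Th t).
have cpsi : {within `[0, Tm th1], continuous psi}.
  apply: drv_within => t /=; rewrite in_itv /= => /hit[th _ <-].
  have [d Dd] := polar_angle_drv (rad0 th) (orbit_radius_drv DK rho0 th0 th).
  rewrite -[X in is_derive X]ThK in Dd.
  by eexists; exact: drv_comp Dd (DTh th).
have Th0 : Th 0 = th0 by rewrite -Tm0 ThK.
have near0 := polar_angle_near (rad (Th 0)) (Th 0).
have near1 := polar_angle_near (rad (Th (Tm th1))) (Th (Tm th1)).
rewrite -/(psi 0) -/(psi (Tm th1)) ?ThK ?Th0 !ltr_norml in near0 near1.
have [T TT ET] : exists2 T, T \in `[0, Tm th1] & `|psi T - psi 0| = 2 * pi.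
  case: d1 => d1.
    have [|T TT ET] := IVT (ltW T1) cpsi (v := psi 0 + 2 * pi).
      by rewrite ge_min le_max; apply/andP; split; apply/orP; [left|right]; lra.
    by exists T => //; rewrite ET addrAC subrr add0r ger0_norm//; lra.
  have [|T TT ET] := IVT (ltW T1) cpsi (v := psi 0 - 2 * pi).
    by rewrite ge_min le_max; apply/andP; split; apply/orP; [right|left]; lra.
  by exists T => //; rewrite ET addrAC subrr add0r normrN ger0_norm//; lra.
move: TT; rewrite in_itv /= => /andP[Tge TT].
have T0 : 0 < T.
  rewrite lt_neqAle Tge andbT; apply/eqP => E; move: ET;
    rewrite -E subrr normr0; lra.
have hit' t : t \in `[0, T] -> exists2 th, `|th - th0| <= 3 * pi & Tm th = t.
  by rewrite in_itv /= => /andP[t0 tT]; apply: hit; rewrite t0 (le_trans tT).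
exists T, (fun t => crv (Th t)); split=> //.
- by move=> t /hit'[th _ <-]; rewrite ThK; exact: Dg.
- by rewrite Th0 Ep /crv /orbit_curve orbit_radius0.
- move=> t /hit'[th thb <-]; rewrite ThK; apply: deltaV.
  have rde : rad th < e.
    apply: (@lt_le_trans _ _ (eta * expR (2 * B)));
      last by rewrite -mulrA -expRD addNr expR0 mulr1.
    apply: (@lt_le_trans _ _ (eta * expR (K th - K th0))).
      by rewrite ltr_pM2r// expR_gt0.
    rewrite ler_pM2l// ler_expR; move: thb;
      rewrite ler_norml => /andP[thb1 thb2].
    have /andP[thpi1 thpi2] := thpi.
    have := HB th; have := HB th0; rewrite !ler_norml.
    have -> : - (4 * pi) <= th <= 4 * pi by apply/andP; split; lra.
    have -> : - (4 * pi) <= th0 <= 4 * pi by apply/andP; split; lra.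
    move=> /(_ isT)/andP[k1 k2] /(_ isT)/andP[k3 k4]; lra.
  have [x1 x2] := qpolar_le th (rad0 th) rde e1.
  by split; rewrite /ball /= sub0r normrN (lt_le_trans _ ed).
- have polar t : exists N, 0 < N /\
      crv (Th t) = (N * cos (psi t), N * sin (psi t)).
    by have [N N0 EN] := polar_angleP (Th t) (rad0 (Th t)); exists N.
  have [N HN] := choice polar.
  exists N, psi; split=> [|t _|//]; last exact: HN.
  by apply: continuous_subspaceW cpsi; apply: subset_itvl; rewrite bnd_simp.
Qed.
End Monodromic.

(** * Closed orbits in the Hamiltonian case *)
Section Center.
Variables (r : nat) (h : bipoly R).
Let m := (r + (t1 + t2))%N.
Hypotheses (hh : pos_qhomog m h).
Hypothesis (h0 : forall q : R * R, q != 0 -> peval h q != 0).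
Let m_gt0 : (0 < m)%N.
Proof. by rewrite /m !addn_gt0 t1_gt0 orbT. Qed.

Let F := hamiltonian h.
Let hF : pos_qhomog_vfield r F := hamiltonian_pos_qhomog hh.
Let wF (q : R * R) : q != 0 -> wedge F q != 0.
Proof.
by move=> q0; rewrite (hamiltonian_wedge hh) mulf_neq0 ?h0// pnatr_eq0 -lt0n.
Qed.

Lemma peval_qpolar rho th : 0 < rho ->
  peval h (qpolar rho th) = rho ^+ m * peval h (cos th, sin th).
Proof. by move=> r0; rewrite /qpolar hh. Qed.

Lemma cos_sin_D2pi (th : R) :
  cos (th + 2 * pi) = cos th /\ sin (th + 2 * pi) = sin th.
Proof. by rewrite mulr_natl cosD2pi sinD2pi. Qed.

Section Orbit.
Variables (K : R -> R) (rho0 th0 : R).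
Hypothesis DK : forall th, D K th (radial_rate F th).
Hypothesis r0 : 0 < rho0.

Let rad := orbit_radius K rho0 th0.
Let crv := orbit_curve K rho0 th0.
Let spd := orbit_speed r F K rho0 th0.
Let rad0 th : 0 < rad th.
Proof. exact: orbit_radius_gt0. Qed.

(** Conservation of h along the orbit, in weighted polar coordinates: it
    determines rho as a function of th, hence periodicity and the fact that the
    orbit is a full level set. *)
Lemma hamiltonian_orbit_level th :
  rad th ^+ m * peval h (cos th, sin th) = peval h (qpolar rho0 th0).
Proof.
rewrite -peval_qpolar// -[rho0 in RHS](orbit_radius0 K rho0 th0).
apply: (@drv0_cst _ (fun u => peval h (crv u))) => u.
have [D1 D2] := orbit_curve_drv hF wF DK th0 r0 u.
have e (w : R * R) : w = (w.1, w.2) by case: w.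
apply: (drv_eq (peval_drv h D1 D2)) => [s|]; first by rewrite -e.
by rewrite -!e /F /= pevalN; ring.
Qed.

Lemma hamiltonian_orbit_radiusP rho th : 0 < rho ->
  peval h (qpolar rho th) = peval h (qpolar rho0 th0) -> rho = rad th.
Proof.
move=> rp; rewrite -(hamiltonian_orbit_level th) peval_qpolar//.
move/(mulIf (h0 (cos_sin_neq0 th))) => /eqP.
by rewrite eqrXn2 ?ltW// => /eqP.
Qed.

Lemma hamiltonian_orbit_radius_periodic th : rad (th + 2 * pi) = rad th.
Proof.
apply: hamiltonian_orbit_radiusP => //;
  rewrite -(hamiltonian_orbit_level (th + 2 * pi)).
by have [-> ->] := cos_sin_D2pi th; rewrite peval_qpolar.
Qed.

Lemma hamiltonian_orbit_curve_periodic th : crv (th + 2 * pi) = crv th.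
Proof.
rewrite /crv /orbit_curve -/rad hamiltonian_orbit_radius_periodic /qpolar.
by have [-> ->] := cos_sin_D2pi th.
Qed.

Lemma hamiltonian_orbit_speed_periodic th : spd (th + 2 * pi) = spd th.
Proof.
rewrite /spd /orbit_speed -/rad hamiltonian_orbit_radius_periodic /time_rate.
by have [-> ->] := cos_sin_D2pi th.
Qed.

(** Let f be h divided by its value on the orbit. Then f vanishes at the origin
    and equals 1 exactly on the orbit, so f < 1 on the component of the origin
    in the complement. In weighted polar coordinates f < 1 says that rho is
    smaller than the radius of the orbit at the same angle, which is bounded. *)
Lemma orbit_curve_surrounds : surrounds_origin (range crv).
Proof.
have pn : peval h (qpolar rho0 th0) != 0 by apply: h0; exact: qpolar_neq0.
split; first by case=> th _ /eqP; apply/negP; exact: qpolar_neq0.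
set C := connected_component _ _.
pose f z := peval h z / peval h (qpolar rho0 th0).
have cf : continuous f by move=> z; apply: cvgM;
  [exact: peval_continuous|exact: cvg_cst].
have C0 : C 0.
  apply: connected_component_refl => -[th _ /eqP]; apply/negP;
    exact: qpolar_neq0.
have f0 : f 0 = 0 by rewrite /f (pos_qhomog_at0 m_gt0 hh) mul0r.
have hit z : f z = 1 -> range crv z.
  move=> fz; have zn : z != 0.
    by apply/eqP => E; move: fz; rewrite E f0 => /esym/eqP; rewrite oner_eq0.
  have [rho [th [rp _ Ez]]] := qpolar_surj zn.
  exists th => //; rewrite Ez /crv /orbit_curve -/rad; congr qpolar.
  apply/esym/hamiltonian_orbit_radiusP => //; rewrite -Ez.
  by apply/divr1_eq.
have fC z : C z -> f z < 1.
  move=> Cz; rewrite ltNge; apply/negP => fz.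
  have cC : connected (f @` C).
    apply: connected_continuous_connected; first exact: component_connected.
    exact: continuous_subspaceT.
  have /connected_intervalP iC := cC.
  have [|w Cw fw] := iC (f 0) (f z) (ex_intro2 _ _ 0 C0 erefl)
                        (ex_intro2 _ _ z Cz erefl) 1.
    by rewrite f0 ler01.
  by have := connected_component_sub Cw; apply; exact: hit.
have pi0 := pi_gt0 R.
have [M HM] : exists M, forall th, - pi <= th <= pi -> `|rad th| <= M.
  apply: drv_bounded => [|th _]; first by lra.
  by eexists; exact: orbit_radius_drv.
have bound z : C z -> `|z| <= M ^+ t1 + M ^+ t2.
  have M0 : 0 <= M by apply: le_trans (HM 0 _); [exact: normr_ge0|lra].
  move=> /fC; have [->|zn] := eqVneq z 0.
    by rewrite normr0 addr_ge0// exprn_ge0.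
  have [rho [th [rp thpi Ez]]] := qpolar_surj zn.
  rewrite Ez /f -(hamiltonian_orbit_level th) peval_qpolar//.
  have hn := h0 (cos_sin_neq0 th).
  rewrite -mulf_div divff// mulr1 ltr_pdivrMr ?exprn_gt0// mul1r.
  rewrite ltr_pXn2r ?nnegrE//; [|exact: ltW|exact: ltW] => rr.
  have rM : rho <= M by apply: (le_trans (ltW rr));
    apply: le_trans (HM th thpi); exact: ler_norm.
  have P k (x : R) : `|x| <= 1 -> `|rho ^+ k * x| <= M ^+ k.
    move=> x1; rewrite normrM normrX gtr0_norm// -[leRHS]mulr1.
    by apply: ler_pM => //; [exact: exprn_ge0 (ltW rp) | apply: lerXn2r;
      rewrite ?nnegrE// ltW].
  rewrite prod_normE /= ge_max; apply/andP; split.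
    by apply: (le_trans (P t1 _ _));
      rewrite ?lerDl ?exprn_ge0// ler_norml cos_geN1 cos_le1.
  by apply: (le_trans (P t2 _ _));
    rewrite ?lerDr ?exprn_ge0// ler_norml sin_geN1 sin_le1.
exists (M ^+ t1 + M ^+ t2); split; first exact: num_real.
by move=> N HN z Cz; apply: le_trans (ltW HN); exact: bound.
Qed.
End Orbit.

(** Since the speed is 2 pi-periodic in th, one turn takes a fixed time L,
    negative if the orbit turns clockwise. So Tm is onto, the solution is
    defined at all times, and it has the period |L|. *)
Lemma hamiltonian_center : center_at_origin F.
Proof.
split; first exact: pos_qhomog_vfield_singular hF.
have pi0 := pi_gt0 R.
rewrite near_withinE; apply: nearW => p pn.
have [K DK] := radial_antiderivative wF.
have [rho0 [th0 [r0 _ Ep]]] := qpolar_surj pn.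
have [Tm [Th [Tm0 DTm ThK DTh Dg]]] := orbit_solution hF wF DK th0 r0.
set crv := orbit_curve K rho0 th0 in Dg *.
have cTm x : {for x, continuous Tm} by exact: drv_cont (DTm x).
pose L := Tm (0 + 2 * pi) - Tm 0.
have TmL th : Tm (th + 2 * pi) = Tm th + L.
  suff -> : L = Tm (th + 2 * pi) - Tm th by rewrite [RHS]addrC subrK.
  apply: (@drv0_cst _ (fun th => Tm (th + 2 * pi) - Tm th)) => u.
  have Ds := drv_comp (g := fun v => v + 2 * pi) (DTm (u + 2 * pi))
    (drvD (drv_id u) (drv_cst (2 * pi) u)).
  apply: (drv_eq (drvB Ds (DTm u))) => //.
  by rewrite hamiltonian_orbit_speed_periodic// addr0 mulr1 subrr.
have L0 : L != 0.
  by rewrite subr_eq0; apply/eqP => /(can_inj ThK); lra.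
have surj := additive_period_surj cTm TmL L0.
pose g t := crv (Th t).
have gTm th : g (Tm th) = crv th by rewrite /g ThK.
have gL t : g (t + L) = g t.
  by have [th <-] := surj t; rewrite -TmL !gTm;
    exact: hamiltonian_orbit_curve_periodic.
have gE : range g = range crv.
  apply/seteqP; split=> [_ [t _ <-]|_ [th _ <-]]; first by exists (Th t).
  by exists (Tm th).
have g0 : g 0 = p by rewrite -Tm0 gTm /crv /orbit_curve orbit_radius0 Ep.
exists g; split=> //; last by rewrite gE; exact: orbit_curve_surrounds.
split.
- by move=> t _; have [th <-] := surj t; rewrite gTm; exact: Dg.
- exists `|L|; first by rewrite normr_gt0.
  move=> t; case: (leP 0 L) => Lp; first by rewrite ger0_norm.
  by rewrite ltr0_norm// -[in RHS](subrK L t) gL.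
(* Half a turn later both coordinates have changed sign. *)
exists (Tm (th0 + pi)); rewrite gTm g0 => E.
set c := fun k => (orbit_radius K rho0 th0 (th0 + pi) / rho0) ^+ k.
have c0 k : 0 < c k by rewrite exprn_gt0// divr_gt0// orbit_radius_gt0.
apply: (quadrant_antipode pn (c0 t1) (c0 t2) ler01).
rewrite !mulN1r -{3 4}E Ep /crv /orbit_curve /qpolar /= cosDpi sinDpi !mulrN
  !opprK.
by rewrite /c !expr_div_n !mulrA !divfK// expf_neq0// gt_eqF.
Qed.
End Center.
End QuasiHomogeneous.

Theorem theorem3 (R : realType) (t1 t2 r : nat) (F : vfield R)
    (t1_gt0 : (0 < t1)%N) (le_t12 : (t1 <= t2)%N) (co_t12 : coprime t1 t2)
    (F_qh : qhomog_vfield t1 t2 r F) :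
  monodromic_at_origin F <->
  center_at_origin (hamiltonian (conservative_part t1 t2 r F)).
Proof.
have t2_gt0 : (0 < t2)%N := leq_trans t1_gt0 le_t12.
have hF : pos_qhomog_vfield t1 t2 r F.
  by case: F_qh => hP hQ; split=> e x y _; [exact: hP | exact: hQ].
have hh := conservative_part_pos_qhomog hF.
have wE (z : R * R) : wedge t1 t2 F z =
    wedge t1 t2 (hamiltonian (conservative_part t1 t2 r F)) z.
  by rewrite (hamiltonian_wedge hh) (@conservative_part_wedge R t1 t2 t1_gt0 r).
split=> [mono|cen].
  apply: (hamiltonian_center t1_gt0 t2_gt0 hh) => q q0.
  have := monodromic_wedge_neq0 t1_gt0 t2_gt0 hF mono q0.
  by rewrite (@conservative_part_wedge R t1 t2 t1_gt0 r) mulf_eq0 negb_or =>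
    /andP[].
apply: (wedge_neq0_monodromic t1_gt0 t2_gt0 le_t12 hF) => q q0; rewrite wE.
exact: center_wedge_neq0 (hamiltonian_pos_qhomog hh) cen q0.
Qed.
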